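(* Let $N\geq 2$ be an integer and let $\lambda'=(\lambda'_1,\dots,\lambda'_{N-1})$ be a tuple of real numbers with $0<\lambda'_i<1$ for $i=1,\dots,N-1$ and $\sum_{0<i<N}\lambda'_i<1$. Let $Q_{\lambda'}$ and $G_{\lambda'}$ be the associated finite sequences of real numbers, each with $N$ terms, defined in the context. Then $$b_+(Q_{\lambda'})=b_+(G_{\lambda'}),\qquad b_-(Q_{\lambda'})=b_-(G_{\lambda'}),\qquad b_0(Q_{\lambda'})=b_0(G_{\lambda'}).$$
   Context: For $\lambda'=(\lambda'_1,\dots,\lambda'_{N-1})$ define $$p_i(\lambda'):=\lambda'_i+\dots+\lambda'_{N-1}-\frac1N\sum_{0<j<N}j\lambda'_j\quad(i=1,\dots,N-1),\qquad p_N(\lambda'):=-\frac1N\sum_{0<j<N}j\lambda'_j.$$ For $i=1,\dots,N$ define $$q_i(\lambda'):=-N\,p_i(\lambda')+\frac{N+1}{2}-i,\qquad g_i(\lambda'):=(-1)^i\prod_{r=1}^{N}2\cos\Big(\pi\big(p_r(\lambda')-\tfrac{i}{N}\big)\Big).$$ Define the finite sequences (terms are counted with repetition) $$Q_{\lambda'}:=\{\cos(\pi q_1(\lambda')),\dots,\cos(\pi q_N(\lambda'))\},\qquad G_{\lambda'}:=\{g_1(\lambda'),\dots,g_N(\lambda')\}.$$ For a finite sequence $S$ of real numbers, $b_+(S)$, $b_-(S)$, $b_0(S)$ denote respectively the number of positive, negative and zero terms of $S$. *)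

(* Defs.v *)
From mathcomp Require Import all_boot all_order all_algebra.
From mathcomp Require Import reals trigo.

Set Implicit Arguments.
Unset Strict Implicit.
Unset Printing Implicit Defensive.

Import Order.TTheory GRing.Theory Num.Theory.

Local Open Scope ring_scope.

(* All indices i, j, r run from 1, while the entries of a tuple are numbered
   from 0: [entry lam j] is lambda'_j, and is only used for 0 < j < N. *)
Definition entry (R : realType) (N : nat) (lam : N.-1.-tuple R) (j : nat) : R :=
  lam`_j.-1.

(* For i = N the first sum is empty, which gives p_N. *)
Definition p_ (R : realType) (N : nat) (lam : N.-1.-tuple R) (i : nat) : R :=
  \sum_(i <= j < N) entry lam j
  - N%:R^-1 * \sum_(1 <= j < N) j%:R * entry lam j.

Definition q_ (R : realType) (N : nat) (lam : N.-1.-tuple R) (i : nat) : R :=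
  - N%:R * p_ lam i + (N%:R + 1) / 2 - i%:R.

Definition g_ (R : realType) (N : nat) (lam : N.-1.-tuple R) (i : nat) : R :=
  (-1) ^+ i *
  \prod_(1 <= r < N.+1) (2 * cos (pi * (p_ lam r - i%:R / N%:R))).

Definition Qseq (R : realType) (N : nat) (lam : N.-1.-tuple R) : seq R :=
  [seq cos (pi * q_ lam i) | i <- iota 1 N].

Definition Gseq (R : realType) (N : nat) (lam : N.-1.-tuple R) : seq R :=
  [seq g_ lam i | i <- iota 1 N].

Definition b_pos (R : realType) (S : seq R) : nat := count (fun x => 0 < x) S.
Definition b_neg (R : realType) (S : seq R) : nat := count (fun x => x < 0) S.
Definition b_zero (R : realType) (S : seq R) : nat := count (fun x => x == 0) S.

(* Main.v *)
Require Import Defs.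
From mathcomp Require Import all_boot all_order all_algebra.
From mathcomp Require Import reals trigo.
From mathcomp Require Import zify ring lra.

Import Order.TTheory GRing.Theory Num.Theory.

Local Open Scope ring_scope.

(** Put the points Y_r = N p_r + 3N/2, for r = 1, ..., N, on a circle of length
    N, next to the N integer points.  The bounds on lambda' say that they are
    distinct and decrease by less than one turn from Y_1 to Y_N.  Up to shifts
    by periods of sine and cosine, cos (pi q_r) is sin (pi (Y_r + r)), and g_i
    is (-1)^i times the product over r of 2 sin (pi (i - Y_r) / N).  Hence, if F
    denotes the integer part,

      - cos (pi q_r) has the sign of (-1)^(F(Y_r) + r), or vanishes if Y_r is an
        integer;
      - g_i has the sign of (-1)^(i + r), where r is the number of points above
        i in the current turn, or vanishes if i is one of the points.

    Now walk once around the circle downwards, and keep track of the level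
    c + m, where c is the number of points passed and m the last integer
    passed.  Each point raises the level by one and each integer lowers it by
    one.  The sign of cos (pi q_r) is the parity of the lower end of the up-step
    made at Y_r, and the sign of g_i is the parity of the lower end of the
    down-step made at i.  When a point meets an integer, an up-step and a
    down-step cancel and both sequences have a zero.  A full turn passes N
    points and N integers and so returns to its initial level; it therefore
    crosses each edge between consecutive levels as often upwards as downwards,
    and the signs on the two sides are equidistributed.

    [sum_level_crossings] is this count for an arbitrary weight on the edges,
    [sgr_sin_pi_truncn] and [sgr_sin_prod] compute the two families of signs,
    and [sign_count_circle] combines them. *)

(** The walk is cut into the stretches from Y_r down to Y_(r+1), with F r the
    integer part of Y_r and w n the weight of the edge between n and n + 1.
    With W a primitive of w, the down-steps of a stretch minus its single
    up-step change W (F r + r) into W (F (r+1) + (r+1)), up to sign; the sum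
    telescopes, and F 0 = F N + N closes the walk.  The weights u of the integers
    and v of the points need to agree with w only when no meeting is possible:
    the hypothesis u (F r) = v r leaves both free where Y_r may equal F r. *)
Lemma sum_level_crossings (N : nat) (F u v w : nat -> nat) :
    (forall r, r < N -> F r.+1 <= F r)%N ->
    F 0%N = (F N + N)%N ->
    (forall r i, r < N -> F r.+1 < i < F r -> u i = w (i + r))%N ->
    (forall r, r < N -> F r.+1 < F r -> u (F r) = v r)%N ->
    (forall r, r < N -> F r.+1 = F r -> v r = w (F r + r))%N ->
  (\sum_((F N).+1 <= i < (F 0).+1) u i = \sum_(0 <= r < N) v r)%N.
Proof.
move=> Fdecr F0 u_in u_top v_flat.
pose W n := (\sum_(0 <= k < n) w k)%N.
have block r : (r < N)%N ->
    (\sum_((F r.+1).+1 <= i < (F r).+1) u i + W (F r.+1 + r.+1)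
       = v r + W (F r + r))%N.
  (* Without an integer in the stretch, the up-step alone contributes.
     Otherwise the top integer F r and the point undo each other, and the
     integers strictly below F r remain. *)
  move=> rN; have := Fdecr r rN; rewrite leq_eqVlt => /orP[/eqP e | lt_F].
    rewrite e big_geq // (v_flat r rN e) add0n addnS /W big_nat_recr //=.
    by rewrite addnC.
  rewrite big_nat_recr //= u_top // addnAC addnC; congr addn.
  rewrite /W addnC.
  rewrite (@big_cat_nat _ _ _ (F r.+1 + r.+1)%N 0 (F r + r)) //=; last by lia.
  congr addn.
  have -> : (F r.+1 + r.+1 = (F r.+1).+1 + r)%N by lia.
  rewrite big_addn addnK big_nat_cond [RHS]big_nat_cond.
  by apply: eq_bigr => i; rewrite andbT => hi; apply: u_in.
have telescope n : (n <= N)%N ->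
    (F n <= F 0)%N /\
    (\sum_((F n).+1 <= i < (F 0).+1) u i + W (F n + n)
       = \sum_(0 <= r < n) v r + W (F 0))%N.
  elim: n => [_|n IHn nN]; first by rewrite !big_geq // addn0.
  have [le_F0 IH] := IHn (ltnW nN); have le_F := Fdecr n nN.
  split; first exact: leq_trans le_F le_F0.
  rewrite (@big_cat_nat _ _ _ (F n).+1) //= [X in _ = (X + _)%N]big_nat_recr //=.
    by have := block n nN; lia.
have [_] := telescope N (leqnn N).
by rewrite -F0 => /addIn.
Qed.

Lemma sum_period (N a : nat) (u : nat -> nat) :
    (forall i, u (i + N)%N = u i) ->
  (\sum_(a.+1 <= i < (a + N).+1) u i = \sum_(1 <= i < N.+1) u i)%N.
Proof.
move=> u_per; elim: a => [//|a <-].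
case: N u_per => [|N] u_per; first by rewrite addn0 !big_geq ?addn0.
rewrite [RHS]big_ltn; last by lia.
rewrite addSn big_nat_recr; last by lia.
by rewrite /= -[(a + N.+1).+1]addSn u_per addnC.
Qed.

Lemma sgr_sin_pi (R : realType) (x : R) :
  0 < x < 1 -> Num.sg (sin (pi * x)) = 1.
Proof.
move=> /andP[x_gt0 x_lt1]; apply/gtr0_sg/sin_gt0_pi.
by rewrite mulr_gt0 ?pi_gt0 //= gtr_pMr ?pi_gt0.
Qed.

Lemma sin_pi_add_nat (R : realType) (x : R) (n : nat) :
  sin (pi * (x + n%:R)) = (-1) ^+ n * sin (pi * x).
Proof. by rewrite mulrDr mulr_natr (alternatingn (@sinDpi R)). Qed.

Lemma sgr_sin_pi_truncn (R : realType) (y : R) (r : nat) : 0 <= y ->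
  Num.sg (sin (pi * (y + r%:R))) =
  if y == (Num.truncn y)%:R then 0 else (-1) ^+ (Num.truncn y + r).
Proof.
move=> y_ge0; have /andP[le_y lt_y] := truncn_itv y_ge0.
have -> : y + r%:R = (y - (Num.truncn y)%:R) + (Num.truncn y + r)%:R.
  by rewrite natrD; ring.
rewrite sin_pi_add_nat sgrM sgrX sgrN1; case: eqVneq => [<-|ne_y].
  by rewrite subrr mulr0 sin0 sgr0 mulr0.
rewrite sgr_sin_pi ?mulr1 // subr_gt0 lt_def ne_y le_y /=.
by rewrite ltrBlDl natr1.
Qed.

(** The values g_i in terms of the points Y_s on a circle of length N: the
    factor of index s vanishes exactly when i is congruent to Y_s modulo N. *)
Definition sin_prod {R : realType} (N : nat) (Y : nat -> R) (i : nat) : R :=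
  (-1) ^+ i * \prod_(1 <= s < N.+1) (2 * sin (pi * ((i%:R - Y s) / N%:R))).

(** Each of the N factors changes sign over one turn, and so does (-1)^i when N
    is odd, so that the two effects cancel. *)
Lemma sin_prodD (R : realType) (N : nat) (Y : nat -> R) (i : nat) :
  (0 < N)%N -> sin_prod N Y (i + N) = sin_prod N Y i.
Proof.
move=> N_gt0; have N_neq0 : N%:R != 0 :> R by rewrite pnatr_eq0 -lt0n.
rewrite /sin_prod (eq_bigr (fun s =>
  -1 * (2 * sin (pi * ((i%:R - Y s) / N%:R))))) => [|s _]; last first.
  have -> : ((i + N)%:R - Y s) / N%:R = (i%:R - Y s) / N%:R + 1%:R.
    by rewrite natrD; field.
  by rewrite sin_pi_add_nat expr1 mulrCA.
rewrite big_split /= prodr_const_nat subn1 /= mulrA; congr (_ * _).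
by rewrite exprD -mulrA -expr2 sqrr_sign mulr1.
Qed.

(** The factors with s <= r are negative and the others positive, because all
    Y_s, for 1 <= s <= N, lie at distance less than N from i.  Here Y_0 = Y_N + N
    is the point Y_N one turn higher; it makes the stretch above Y_1 one of the
    stretches. *)
Lemma sgr_sin_prod (R : realType) (N : nat) (Y : nat -> R) (r i : nat) :
    (forall s t, (s < t <= N)%N -> Y t < Y s) -> Y 0%N = Y N + N%:R ->
    (r < N)%N -> Y r.+1 < i%:R < Y r ->
  Num.sg (sin_prod N Y i) = (-1) ^+ (i + r).
Proof.
move=> Ydecr Y0 rN /andP[lt_i i_lt].
have Yle s t : (s <= t <= N)%N -> Y t <= Y s.
  case/andP; rewrite leq_eqVlt => /orP[/eqP->//|st tN].
  by rewrite ltW // Ydecr // st.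
have N_gt0 : 0 < N%:R :> R by rewrite ltr0n (leq_trans _ rN).
rewrite sgrM sgrX sgrN1 exprD; congr (_ * _).
rewrite (big_morph _ (@sgrM R) (sgr1 R)).
rewrite (@big_cat_nat _ _ _ r.+1) ?ltnS ?(ltnW rN) //=.
rewrite (eq_big_nat _ _ (F2 := fun=> -1)) => [|s /andP[s_gt0 s_le]].
  rewrite [X in _ * X]big_nat [X in _ * X]big1 => [|s /andP[s_gt s_le]].
    by rewrite prodr_const_nat subn1 mulr1.
  rewrite sgrM gtr0_sg ?ltr0n // mul1r sgr_sin_pi //.
  have h1 : Y s <= Y r.+1 by apply: Yle; lia.
  have h2 : Y N <= Y s by apply: Yle; lia.
  have h3 : Y r <= Y 0%N by apply: Yle; lia.
  by rewrite divr_gt0 ?ltr_pdivrMr ?mul1r //; lra.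
rewrite sgrM gtr0_sg ?ltr0n // mul1r.
rewrite -[i%:R - Y s]opprB mulNr mulrN sinN sgrN sgr_sin_pi //.
have h1 : Y r <= Y s by apply: Yle; lia.
have h2 : Y s < Y 0%N by apply: Ydecr; lia.
have h3 : Y N <= Y r.+1 by apply: Yle; lia.
by rewrite divr_gt0 ?ltr_pdivrMr ?mul1r //; lra.
Qed.

(** For r = 0 it is the factor of Y_N that vanishes, as sin pi = 0. *)
Lemma sin_prod_eq0 (R : realType) (N : nat) (Y : nat -> R) (r i : nat) :
    (r < N)%N -> Y 0%N = Y N + N%:R -> Y r = i%:R -> sin_prod N Y i = 0.
Proof.
move=> rN Y0 Yr; rewrite /sin_prod; apply/eqP; rewrite mulf_eq0; apply/orP.
right; have N_neq0 : N%:R != 0 :> R by rewrite pnatr_eq0 -lt0n (leq_trans _ rN).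
case: r => [|r] in rN Yr *; last first.
  rewrite (bigD1_seq r.+1) ?iota_uniq ?mem_index_iota //=; last by lia.
  by rewrite Yr subrr mul0r mulr0 sin0 mulr0 mul0r.
rewrite big_nat_recr //= -Yr Y0 addrAC subrr add0r divff // mulr1.
by rewrite sinpi !mulr0.
Qed.

(** The turn runs from Y_0 down to Y_N, so its integers are those of the interval
    from F N + 1 to F N + N, and its points are Y_0, ..., Y_(N-1).  Periodicity
    brings both index sets back to 1, ..., N.  Taking Y_N >= 0 keeps all the
    integer parts among the natural numbers. *)
Lemma sign_count_circle (R : realType) (N : nat) (Y : nat -> R) (P : pred R) :
    (0 < N)%N -> (forall x, P (Num.sg x) = P x) ->
    (forall s, (s < N)%N -> Y s.+1 < Y s) ->
    Y 0%N = Y N + N%:R -> 0 <= Y N ->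
  (\sum_(1 <= r < N.+1) P (sin (pi * (Y r + r%:R)%R))
     = \sum_(1 <= i < N.+1) P (sin_prod N Y i))%N.
Proof.
move=> N_gt0 P_sg Ystep Y0 YN_ge0.
have Ydecr s t : (s < t <= N)%N -> Y t < Y s.
  elim: t => // t IHt /andP[]; rewrite ltnS leq_eqVlt.
  case/orP=> [/eqP-> | st] tN; first exact: Ystep.
  by apply: lt_trans (Ystep _ tN) _; apply: IHt; rewrite st ltnW.
have Y_ge0 r : (r <= N)%N -> 0 <= Y r.
  rewrite leq_eqVlt => /orP[/eqP->//|rN]; apply: le_trans YN_ge0 _.
  by rewrite ltW // Ydecr // rN leqnn.
pose F r := Num.truncn (Y r).
have F_itv r (rN : (r <= N)%N) := truncn_itv (Y_ge0 r rN).
have F0 : F 0%N = (F N + N)%N.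
  by rewrite /F Y0 addrC truncnD ?natrK 1?addnC // natr_nat.
pose v r := P (sin (pi * (Y r + r%:R))).
have vE r : (r <= N)%N ->
    v r = P (if Y r == (F r)%:R then 0 else (-1) ^+ (F r + r)).
  by move=> rN; rewrite /v -P_sg sgr_sin_pi_truncn // Y_ge0.
have v0 : v 0%N = v N.
  by rewrite !vE // F0 addn0 Y0 natrD (inj_eq (addIr _)).
transitivity (\sum_(0 <= r < N) v r)%N.
  by rewrite big_nat_recr //= [RHS]big_ltn // v0 addnC big_add1.
have u_per i : nat_of_bool (P (sin_prod N Y (i + N))) = P (sin_prod N Y i).
  by rewrite sin_prodD.
rewrite -(@sum_period N (F N) _ u_per) -F0.
symmetry.
apply: (@sum_level_crossings N F _ v (fun n => P ((-1) ^+ n))) => //.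
- by move=> r rN; apply/le_truncn/ltW/Ystep.
- move=> r i rN /andP[lt_i i_lt]; rewrite -P_sg (@sgr_sin_prod _ _ _ r) //.
  have /andP[_ Yr1] := F_itv r.+1 rN; have /andP[Yr _] := F_itv r (ltnW rN).
  apply/andP; split; first by apply: lt_le_trans Yr1 _; rewrite ler_nat.
  by apply: lt_le_trans Yr; rewrite ltr_nat.
  (* The top integer of a stretch is its upper end, where both values vanish,
     or lies strictly inside. *)
- move=> r rN lt_F; rewrite vE ?(ltnW rN) //; case: eqVneq => [e|ne].
    by rewrite (@sin_prod_eq0 _ _ _ r).
  rewrite -P_sg (@sgr_sin_prod _ _ _ r) //.
  have /andP[_ Yr1] := F_itv r.+1 rN; have /andP[Yr _] := F_itv r (ltnW rN).
  rewrite (lt_le_trans Yr1) ?ler_nat //= lt_def ne; exact: Yr.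
  (* Y_r cannot be an integer here, as Y_(r+1) < Y_r has the same integer
     part. *)
- move=> r rN e; rewrite vE ?(ltnW rN) // ifN //.
  have /andP[Yr1 _] := F_itv r.+1 rN; rewrite gt_eqF // -e.
  exact: le_lt_trans Yr1 (Ystep r rN).
Qed.

(** A zero of the product defining g occurs at N (p_r + 1/2).  The additional turn
    makes the points positive, since p_N > -1, and the value at 0 is the point
    of index N raised by one more turn. *)
Definition circle_point {R : realType} (N : nat) (lam : N.-1.-tuple R)
    (r : nat) : R :=
  if r == 0%N then N%:R * p_ lam N + N%:R * (5 / 2)
  else N%:R * p_ lam r + N%:R * (3 / 2).

Lemma count_iota (T : Type) (a : pred T) (f : nat -> T) (N : nat) :
  count a [seq f i | i <- iota 1 N] = (\sum_(1 <= i < N.+1) a (f i))%N.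
Proof.
rewrite count_map -sum1_count big_mkcond /index_iota subn1 /=.
by apply: eq_bigr => i _; case: ifP.
Qed.

Theorem theorem1 (R : realType) (N : nat) (lam : N.-1.-tuple R)
    (hN : (2 <= N)%N)
    (hlam : forall i : nat, (0 < i < N)%N -> 0 < entry lam i < 1)
    (hsum : \sum_(1 <= i < N) entry lam i < 1) :
  b_pos (Qseq lam) = b_pos (Gseq lam) /\
  b_neg (Qseq lam) = b_neg (Gseq lam) /\
  b_zero (Qseq lam) = b_zero (Gseq lam).
Proof.
have N_gt0 : (0 < N)%N by apply: leq_trans hN.
have NR_gt0 : 0 < N%:R :> R by rewrite ltr0n.
set Y := circle_point N lam.
have Y0 : Y 0%N = Y N + N%:R.
  by rewrite /Y /circle_point eqxx gtn_eqF //; lra.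
have Ystep s : (s < N)%N -> Y s.+1 < Y s.
  rewrite /Y /circle_point /=; case: s => [|s] sN /=.
    (* That the sum of the weights is below 1 says that Y_1 - Y_N < N. *)
    have -> : p_ lam 1 = p_ lam N + \sum_(1 <= i < N) entry lam i.
      by rewrite /p_ [X in _ = X - _ + _]big_geq //; ring.
    by rewrite mulrDr; move: hsum; rewrite -(ltr_pM2l NR_gt0) => h; lra.
  rewrite ltrD2r ltr_pM2l // ltrD2r [ltRHS]big_ltn // ltrDr.
  by have /andP[] := hlam s.+1 sN.
have YN_ge0 : 0 <= Y N.
  rewrite /Y /circle_point gtn_eqF // /p_ big_geq // sub0r mulrN mulVKf ?gt_eqF //.
  have : \sum_(1 <= j < N) j%:R * entry lam j
      <= \sum_(1 <= j < N) N%:R * entry lam j.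
    rewrite !big_nat; apply: ler_sum => j hj.
    by rewrite ler_pM2r ?ler_nat; [lia | have /andP[] := hlam j hj].
  rewrite -mulr_sumr; move: hsum; rewrite -(ltr_pM2l NR_gt0); lra.
have QE r : (0 < r)%N -> cos (pi * q_ lam r) = sin (pi * (Y r + r%:R)).
  move=> r_gt0; rewrite /q_ /Y /circle_point gtn_eqF //.
  rewrite -cosBpihalf -cosN -(periodicn (@cosD2pi R) N).
  by congr cos; rewrite -[_ *+ N]mulr_natr -[pi *+ 2]mulr_natr; field.
have GE i : g_ lam i = sin_prod N Y i.
  rewrite /g_ /sin_prod; congr (_ * _).
  apply: eq_big_nat => s /andP[s_gt0 _]; congr (_ * _).
  rewrite /Y /circle_point gtn_eqF // -cosBpihalf -cosN -[RHS]cosD2pi.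
  by congr cos; field; exact: lt0r_neq0.
have main (P : pred R) : (forall x, P (Num.sg x) = P x) ->
    count P (Qseq lam) = count P (Gseq lam).
  move=> P_sg; rewrite !count_iota.
  rewrite (eq_big_nat _ _ (F2 := fun r => P (sin (pi * (Y r + r%:R))) : nat)).
    by rewrite sign_count_circle //; apply: eq_bigr => i _; rewrite GE.
  by move=> r /andP[r_gt0 _]; rewrite QE.
split; [|split]; apply: main => x.
- exact: sgr_gt0.
- exact: sgr_lt0.
- exact: sgr_eq0.
Qed.
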